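(* Let $(A,p,0,1)$ be a set $A$ with a ternary operation $p:A\times A\times A\to A$ and two constants $0,1\in A$ satisfying axioms (T1)--(T4). For $\bar a=p(1,a,0)$, $a\cdot b=p(0,a,b)$ and $a+b=p(a,b,\bar a)$, the following conditions are equivalent: (i) $(A,+,\cdot,0,1)$ is a unitary (right) near-ring of characteristic $2$; (ii) $p(a,b,c)=a+(b\cdot(a+c))$ for all $a,b,c\in A$; (iii) $a+a=0$ for all $a\in A$; (iv) $(a+b)\cdot c=(a\cdot c)+(b\cdot c)$ for all $a,b,c\in A$.
   Context: Axioms, for all $a,b,c,b_1,b_2,b_3\in A$: (T1) $p(0,a,1)=a$; (T2) $p(a,0,b)=a=p(b,1,a)$; (T3) $p(a,b,a)=a$; (T4) $p(a,p(b_1,b_2,b_3),c)=p(p(a,b_1,c),b_2,p(a,b_3,c))$. A unitary (right) near-ring $(A,+,\cdot,0,1)$ is a set such that $(A,+,0)$ is a group, $(A,\cdot,1)$ is a monoid, and right distributivity $(a+b)\cdot c=(a\cdot c)+(b\cdot c)$ holds. It has characteristic $2$ when $b+b=0$ for all $b$. *)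

(* Defs.v *)
From mathcomp Require Import all_boot.

Set Implicit Arguments.
Unset Strict Implicit.
Unset Printing Implicit Defensive.

Record ternary_axioms (A : Type) (p : A -> A -> A -> A) (zero one : A) : Prop :=
  TernaryAxioms {
    T1 : forall a, p zero a one = a;
    T2l : forall a b, p a zero b = a;
    T2r : forall a b, p b one a = a;
    T3 : forall a b, p a b a = a;
    T4 : forall a b1 b2 b3 c,
      p a (p b1 b2 b3) c = p (p a b1 c) b2 (p a b3 c)
  }.

Section DerivedOperations.
Variables (A : Type) (p : A -> A -> A -> A) (zero one : A).

Definition tbar (a : A) : A := p one a zero.
Definition tmul (a b : A) : A := p zero a b.
Definition tadd (a b : A) : A := p a b (tbar a).

End DerivedOperations.

(* Unbundled predicates: the carrier is an arbitrary type, with no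
   choiceType structure, and the operations are the derived ones above. *)

Record is_group (A : Type) (op : A -> A -> A) (e : A) : Prop := IsGroup {
  group_assoc : associative op;
  group_idl : left_id e op;
  group_idr : right_id e op;
  group_inv : exists inv : A -> A, left_inverse e inv op /\ right_inverse e inv op
}.

Record is_monoid (A : Type) (op : A -> A -> A) (e : A) : Prop := IsMonoid {
  monoid_assoc : associative op;
  monoid_idl : left_id e op;
  monoid_idr : right_id e op
}.

(* [left_distributive mul add] is (a + b) c = a c + b c, which near-ring theory
   calls right distributivity. *)
Record is_unitary_near_ring (A : Type) (add mul : A -> A -> A) (zero one : A)
    : Prop := IsUnitaryNearRing {
  near_ring_add : is_group add zero;
  near_ring_mul : is_monoid mul one;
  near_ring_distr : left_distributive mul add
}.

Definition characteristic2 (A : Type) (add : A -> A -> A) (zero : A) : Prop :=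
  forall b, add b b = zero.

(* Main.v *)
Require Import Defs.
From mathcomp Require Import all_boot.

(** Write [x + y] and [x * y] for the derived operations and [bar] for the
    derived complement.  Read [p a b c] as a conditional: [b] selects between
    [a] (at [zero]) and [c] (at [one]), and T4 says that a nested condition may
    be pushed out of the selector.

    The axioms alone make multiplication a monoid with left-absorbing zero, and
    addition a monoid as well: [bar] swaps the two branches ([p_bar]), so
    [x + b] is a conditional with branches [x] and [bar x], and
    [bar (a + b) = a + bar b] is what associativity asks for.  What is missing
    for a near-ring are additive inverses and distributivity.

    The key identity is that left translations distribute over conditionals,
    [x + p a b c = p (x + a) b (x + c)] ([add_p]).  When [a + a = 0], taking
    [x = a] turns the right-hand side into [b * (a + c)], and adding [a] once
    more yields the formula of (ii).  Conversely (ii) at [b = 1], [c = 0] reads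
    [0 = a + a].  Since a monoid of exponent 2 is commutative, (ii) then
    expands [(a + b) * c], which is a conditional on [b], to [a * c + b * c].
    Finally [1 + 1 = 0] holds in every such algebra, so distributivity gives
    [c + c = (1 + 1) * c = 0], and with it the inverses. *)

Section TernaryAlgebra.
Variables (A : Type) (p : A -> A -> A -> A) (zero one : A).
Hypothesis Hp : ternary_axioms p zero one.

Local Notation bar := (tbar p zero one).
Local Notation add := (tadd p zero one).
Local Notation mul := (tmul p zero).

Lemma mul_monoid : is_monoid mul one.
Proof.
case: Hp => t1 t2l t2r t3 t4; split=> [a b c|a|a] //; rewrite /tmul //.
by rewrite t4 t2l.
Qed.

Lemma mul0 a : mul zero a = zero.
Proof. exact: (T2l Hp). Qed.

Lemma p_bar a b c : p a (bar b) c = p c b a.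
Proof. by rewrite /tbar (T4 Hp) (T2r Hp) (T2l Hp). Qed.

Lemma barK : involutive bar.
Proof. by move=> a; rewrite {1}/tbar p_bar (T1 Hp). Qed.

Lemma add0 : left_id zero add.
Proof. by move=> a; rewrite /tadd /tbar (T2l Hp) (T1 Hp). Qed.

Lemma addr0 : right_id zero add.
Proof. by move=> a; exact: (T2l Hp). Qed.

Lemma add11 : add one one = zero.
Proof. by rewrite /tadd (T2r Hp) /tbar (T2r Hp). Qed.

Lemma bar_add a b : bar (add a b) = add a (bar b).
Proof. by rewrite /tadd p_bar {1}/tbar (T4 Hp) -!/(bar _) barK. Qed.

(** Left translation by [x] evaluates a conditional with the fixed branches
    [x] and [bar x], so T4 applies. *)
Lemma add_p x a b c : add x (p a b c) = p (add x a) b (add x c).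
Proof. exact: (T4 Hp). Qed.

Lemma add_assoc : associative add.
Proof. by move=> a b c; rewrite {2}/tadd add_p -bar_add. Qed.

(** Right multiplication by [c] evaluates a conditional with the fixed branches
    [zero] and [c], so T4 applies here too. *)
Lemma mul_p a b d c : mul (p a b d) c = p (mul a c) b (mul d c).
Proof. exact: (T4 Hp). Qed.

Section ExponentTwo.
Hypothesis addaa : forall a, add a a = zero.

Lemma addKl a b : add a (add a b) = b.
Proof. by rewrite add_assoc addaa add0. Qed.

Lemma add_comm : commutative add.
Proof.
move=> a b; rewrite -[RHS](addKl (add a b)).
by rewrite -(add_assoc a b (add b a)) addKl addaa addr0.
Qed.

Lemma p_of_add_mul a b c : p a b c = add a (mul b (add a c)).
Proof. by rewrite -[LHS](addKl a) add_p addaa. Qed.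

Lemma mul_add_distr : left_distributive mul add.
Proof.
move=> a b c; rewrite {1}/tadd mul_p p_of_add_mul.
(* [bar a * c] equals [c + a * c], so the difference of the branches is [c]. *)
have -> : mul (bar a) c = add c (mul a c).
  by rewrite {1}/tmul p_bar p_of_add_mul addr0.
by rewrite [add c _]add_comm addKl.
Qed.

End ExponentTwo.

Lemma near_ring_of_distr :
  left_distributive mul add ->
  is_unitary_near_ring add mul zero one /\ characteristic2 add zero.
Proof.
move=> distr; have addcc c : add c c = zero.
  by rewrite -{1 2}[c](monoid_idl mul_monoid) -distr add11 mul0.
split=> //; split=> //; last exact: mul_monoid.
split; [exact: add_assoc | exact: add0 | exact: addr0 |].
by exists id; split.
Qed.

End TernaryAlgebra.

Theorem theorem5p3 (A : Type) (p : A -> A -> A -> A) (zero one : A)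
    (Hp : ternary_axioms p zero one) :
  let add := tadd p zero one in
  let mul := tmul p zero in
  [<-> is_unitary_near_ring add mul zero one /\ characteristic2 add zero;
       forall a b c : A, p a b c = add a (mul b (add a c));
       forall a : A, add a a = zero;
       forall a b c : A, mul (add a b) c = add (mul a c) (mul b c)].
Proof.
move=> add mul; tfae.
- by move=> [_ addaa]; exact: p_of_add_mul Hp addaa.
- move=> pE a; have := pE a one zero.
  rewrite (T2r Hp) /add /mul (addr0 _ _ _ _ Hp).
  by rewrite (monoid_idl (mul_monoid _ _ _ _ Hp)).
- by move=> addaa; exact: mul_add_distr Hp addaa.
- exact: near_ring_of_distr Hp.
Qed.
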